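(* Let $p$ be the mesh pattern $(12,R)$ with $R=\{(0,0),(0,1),(1,0),(1,2),(2,1),(2,2)\}$, let $E(t,u)=\sum_{n\ge0}t^n\sum_{\sigma\in K_n}u^{p(\sigma)}$, and let $P(t)=\sum_{n\ge0}|K_n(p)|t^n$. Then $$P(t)=\frac{(1+t)^2A(t)}{(1+t)^2+t^2\big(A(t)-t-1\big)A(t)},\qquad E(t,u)=\frac{(1+t)^2A(t)}{1+t\Big(2+t\big(1+(1-u)(A(t)-t-1)A(t)\big)\Big)}.$$ The initial terms of $E(t,u)$ are $1+t+2t^4+14t^5+(88+2u)t^6+(632+14u)t^7+(5152+90u)t^8+\cdots$.
   Context: A permutation $\sigma=\sigma_1\cdots\sigma_n$ of $\{1,\dots,n\}$ is a king permutation if $|\sigma_{i+1}-\sigma_i|>1$ for all $1\le i\le n-1$. $K_n$ is the set of king permutations of length $n$ ($K_0$ = the empty permutation, $K_1=\{1\}$) and $A(t)=\sum_{n\ge0}|K_n|t^n$ (known to equal $\sum_{n\ge0}n!\,t^n(1-t)^n/(1+t)^n$). For a mesh pattern $p=(12,R)$ with $R\subseteq\{0,1,2\}^2$, an occurrence of $p$ in $\sigma\in S_n$ is a pair of positions $i_1<i_2$ with $\sigma_{i_1}<\sigma_{i_2}$ such that for every $(x,y)\in R$ there is no position $m$ with $i_x<m<i_{x+1}$ and $v_y<\sigma_m<v_{y+1}$, where $i_0=0$, $i_3=n+1$, $v_0=0$, $v_1=\sigma_{i_1}$, $v_2=\sigma_{i_2}$, $v_3=n+1$ (first coordinate of a box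 indexes positions, second values). $p(\sigma)$ is the number of occurrences of $p$ in $\sigma$; $K_n(p)$ is the set of king $n$-permutations with $p(\sigma)=0$. *)

(* Defs.v *)
From HB Require Import structures.
From mathcomp Require Import all_boot all_order all_fingroup all_algebra.
From mathcomp Require Import boolp.

Set Implicit Arguments.
Unset Strict Implicit.
Unset Printing Implicit Defensive.

Import GRing.Theory.
Local Open Scope ring_scope.

(* Formal power series as a ring.  The product is the Cauchy product, the      *)
(* units are the series with a unit as constant coefficient, and x^-1 is the   *)
(* genuine inverse of a unit x (as always in MathComp, x^-1 = x otherwise).    *)

Record fps (R : Type) := Fps { fcoef : nat -> R }.

HB.instance Definition _ (R : Type) := gen_eqMixin (fps R).
HB.instance Definition _ (R : Type) := gen_choiceMixin (fps R).

Lemma fpsP (R : Type) (f g : fps R) : fcoef f =1 fcoef g <-> f = g.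
Proof.
split=> [|-> //]; case: f g => [f] [g] /= fg.
by congr Fps; apply: funext.
Qed.

Section FpsRing.
Variable R : comNzRingType.
Implicit Types f g h : fps R.

Definition fpsC (c : R) : fps R := Fps (fun n => if n is 0 then c else 0).
Definition fpsX : fps R := Fps (fun n => (n == 1%N)%:R).

Definition fps_add f g : fps R := Fps (fun n => fcoef f n + fcoef g n).
Definition fps_opp f : fps R := Fps (fun n => - fcoef f n).
Definition fps_mul f g : fps R :=
  Fps (fun n => \sum_(i < n.+1) fcoef f i * fcoef g (n - i)).

Fact fps_addA : associative fps_add.
Proof. by move=> f g h; apply/fpsP => n; rewrite /= addrA. Qed.
Fact fps_addC : commutative fps_add.
Proof. by move=> f g; apply/fpsP => n; rewrite /= addrC. Qed.
Fact fps_add0 : left_id (fpsC 0) fps_add.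
Proof. by move=> f; apply/fpsP => -[|n]; rewrite /= add0r. Qed.
Fact fps_addN : left_inverse (fpsC 0) fps_opp fps_add.
Proof. by move=> f; apply/fpsP => -[|n]; rewrite /= addNr. Qed.

HB.instance Definition _ :=
  GRing.isZmodule.Build (fps R) fps_addA fps_addC fps_add0 fps_addN.

Definition fps_trunc N f : {poly R} := \poly_(i < N) fcoef f i.

Lemma coef_trunc_mul N n f g : (n < N)%N ->
  (fps_trunc N f * fps_trunc N g)`_n = fcoef (fps_mul f g) n.
Proof.
move=> nN; rewrite coefM /=; apply: eq_bigr => i _; rewrite !coef_poly.
have iN : (i < N)%N by rewrite (leq_trans (ltn_ord i)).
by rewrite iN (leq_ltn_trans (leq_subr i n) nN).
Qed.

Fact fps_mulC : commutative fps_mul.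
Proof.
by move=> f g; apply/fpsP => n; rewrite -!(@coef_trunc_mul n.+1) // mulrC.
Qed.

Fact fps_mulA : associative fps_mul.
Proof.
move=> f g h; apply/fpsP => n.
transitivity ((fps_trunc n.+1 f * fps_trunc n.+1 g * fps_trunc n.+1 h)`_n).
  rewrite -mulrA coefM; apply: eq_bigr => i _.
  by rewrite coef_trunc_mul ?ltnS ?leq_subr // coef_poly ltn_ord.
rewrite coefM; apply: eq_bigr => i _.
by rewrite coef_trunc_mul // coef_poly ltnS leq_subr.
Qed.

Fact fps_mul1 : left_id (fpsC 1) fps_mul.
Proof.
move=> f; apply/fpsP => n; rewrite /= big_ord_recl /= mul1r subn0 big1 ?addr0 //.
by move=> i _; rewrite mul0r.
Qed.

Fact fps_mulDl : left_distributive fps_mul fps_add.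
Proof.
move=> f g h; apply/fpsP => n; rewrite /= -big_split.
by apply: eq_bigr => i _; rewrite /= mulrDl.
Qed.

Fact fps_oner_neq0 : fpsC 1 != 0.
Proof.
by apply/eqP => /fpsP /(_ 0); apply/eqP; rewrite /= oner_neq0.
Qed.

HB.instance Definition _ := GRing.Zmodule_isComNzRing.Build (fps R)
  fps_mulA fps_mulC fps_mul1 fps_mulDl fps_oner_neq0.

Lemma fcoefM f g n :
  fcoef (f * g) n = \sum_(i < n.+1) fcoef f i * fcoef g (n - i).
Proof. by []. Qed.

Lemma fcoef1 n : fcoef (1 : fps R) n = (n == 0%N)%:R.
Proof. by case: n. Qed.

End FpsRing.

Section FpsUnit.
Variable R : comUnitRingType.
Implicit Types f g : fps R.

(* The first n coefficients of 1 / f, computed from                            *)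
(*   g_k = f_0^-1 * ([k = 0] - \sum_(i < k) g_i * f_(k - i)).                  *)
Fixpoint fps_inv_seq f n : seq R :=
  if n is k.+1 then
    let s := fps_inv_seq f k in
    rcons s ((fcoef f 0)^-1 *
             ((k == 0%N)%:R - \sum_(i < k) s`_i * fcoef f (k - i)))
  else [::].

Definition fps_unit : pred (fps R) := fun f => fcoef f 0 \is a GRing.unit.
Definition fps_inv f : fps R :=
  if fps_unit f then Fps (fun n => (fps_inv_seq f n.+1)`_n) else f.

Lemma size_fps_inv_seq f n : size (fps_inv_seq f n) = n.
Proof. by elim: n => //= n IH; rewrite size_rcons IH. Qed.

Lemma nth_fps_inv_seq f n i : (i < n)%N ->
  (fps_inv_seq f n)`_i = (fps_inv_seq f i.+1)`_i.
Proof.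
elim: n => // n IH; rewrite ltnS leq_eqVlt => /orP[/eqP-> //|lt_in].
by rewrite [LHS]/= nth_rcons size_fps_inv_seq lt_in IH.
Qed.

Fact fps_mulVf : {in fps_unit, left_inverse 1 fps_inv *%R}.
Proof.
move=> f Uf; rewrite /fps_inv (Uf : fps_unit f); apply/fpsP => n.
rewrite fcoefM fcoef1 big_ord_recr subnn [fcoef _ n]/=.
rewrite nth_rcons size_fps_inv_seq ltnn eqxx mulrC mulVKr //.
set S := (X in _ - X); rewrite [LHS]addrC -[RHS](subrK S).
congr (_ + _); apply: eq_bigr => i _.
by rewrite (nth_fps_inv_seq f (ltn_ord i)).
Qed.

Fact fps_unitP f g : g * f = 1 -> fps_unit f.
Proof.
move=> /fpsP/(_ 0); rewrite fcoefM big_ord1 subnn fcoef1 => gf1.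
by apply/unitrP; exists (fcoef g 0); rewrite [fcoef f 0 * _]mulrC.
Qed.

Fact fps_invN : {in [predC fps_unit], fps_inv =1 id}.
Proof. by move=> f; rewrite inE /fps_inv /in_mem /= => /negPf->. Qed.

HB.instance Definition _ := GRing.ComNzRing_hasMulInverse.Build (fps R)
  fps_mulVf fps_unitP fps_invN.

Lemma fps_unitE f : (f \is a GRing.unit) = (fcoef f 0 \is a GRing.unit).
Proof. by []. Qed.

End FpsUnit.

Arguments fpsX {R}.

(* Permutations of {1, ..., n} are represented by 'S_n, acting on              *)
(* {0, ..., n - 1}; position i and value s i stand for i + 1 and s i + 1.      *)

Definition king n (s : 'S_n) : bool :=
  [forall i : 'I_n, forall j : 'I_n,
     (j == i.+1 :> nat) ==> (1 < `|(s j)%:Z - (s i)%:Z|)].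

Definition kings n : {set 'S_n} := [set s | king s].

Definition mesh := {set 'I_3 * 'I_3}.

(* gridline n a b x = c_x, where (c_0, c_1, c_2, c_3) = (0, a, b, n + 1) *)
Definition gridline n (a b x : nat) : nat := nth 0%N [:: 0; a; b; n.+1]%N x.

Definition in_box n (s : 'S_n) (i1 i2 : 'I_n) (x y : nat) (m : 'I_n) : bool :=
  let pos := gridline n i1.+1 i2.+1 in
  let val := gridline n (s i1).+1 (s i2).+1 in
  (pos x < m.+1 < pos x.+1)%N && (val y < (s m).+1 < val y.+1)%N.

Definition occurrence12 n (R : mesh) (s : 'S_n) (i : 'I_n * 'I_n) : bool :=
  [&& (i.1 < i.2)%N, (s i.1 < s i.2)%N &
      [forall b in R, forall m : 'I_n, ~~ in_box s i.1 i.2 b.1 b.2 m]].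

Definition occ12 n (R : mesh) (s : 'S_n) : nat :=
  #|[set i | occurrence12 R s i]|.

Definition kings_avoiding (R : mesh) n : {set 'S_n} :=
  [set s in kings n | occ12 R s == 0%N].

Definition mesh_p : mesh :=
  [set b : 'I_3 * 'I_3 | (val b.1, val b.2) \in
     [:: (0, 0); (0, 1); (1, 0); (1, 2); (2, 1); (2, 2)]%N].

Definition gfA (R : comNzRingType) : fps R := Fps (fun n => #|kings n|%:R).

Definition gfP : fps int := Fps (fun n => #|kings_avoiding mesh_p n|%:R).

(* E(t, u) as a power series in t over Z[u], with u the variable of {poly int} *)
Definition gfE : fps {poly int} :=
  Fps (fun n => \sum_(s in kings n) 'X^(occ12 mesh_p s)).

(* Main.v *)
Require Import Defs.
From mathcomp Require Import all_boot all_order all_fingroup all_algebra.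
From mathcomp Require Import zify ring.
Import GRing.Theory.

(* The unshaded boxes of the pattern are (0,2), (1,1) and (2,0), so an          *)
(* occurrence in s is the same thing as a skew-sum decomposition                *)
(*   s = L (-) (1 (+) M (+) 1) (-) R.                                           *)
(* Such an s is king exactly when L and R are king and M is a king permutation  *)
(* that is nonempty, does not start with its minimum and does not end with its  *)
(* maximum.  Stripping the initial minimum and the final maximum of a king      *)
(* permutation shows that these M have generating function                      *)
(*   B = (A - t - 1) / (1 + t)^2.                                               *)
(* Writing u^p - 1 as (u - 1) times the sum, over the occurrences, of u to the  *)
(* number of occurrences further right, and noting that the occurrences to the  *)
(* right of the chosen one are those of R, gives                                *)
(*   E - A = (u - 1) t^2 A B E.                                                 *)
(* This holds for u in any commutative ring; u = 0 yields P.                    *)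

Set Implicit Arguments.
Unset Strict Implicit.
Unset Printing Implicit Defensive.

Local Open Scope nat_scope.

(** The shaded boxes force the entries left of, between and right of the two points of an occurrence
    to lie above, between and below them in value. Each occurrence thus spans one
    skew-indecomposable component. Occurrences are disjoint and ordered from left to right, and
    choosing one of them splits the permutation into independent blocks $L$, $M$, $R$ ([perm_glue]).
    The occurrences after the chosen one are exactly those of $R$ ([count_occ_after]).

    Reading $u^p-1=(u-1)(1+\cdots+u^{p-1})$ as a sum over occurrences ([expr_count]) gives the
    equation [occ_gf_rec]: $A$ counts $L$, $B$ counts $M$, $E$ counts $R$ with its weight, and $t^2$
    stands for the two points. [capped_gfE] eliminates $B$. The resulting equation [occ_gf_eq] is
    linear in $E$, and its coefficient has constant term 1, so it can be inverted.

    All of this is done on sequences. The return to ['S_n] rests on [occurrence12E]: the first point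
    of an occurrence determines the second, so [occ12E] may count first positions only. *)

Definition apart (x y : nat) : bool := (x.+1 < y) || (y.+1 < x).

Definition king_seqs n : seq (seq nat) :=
  [seq s <- permutations (iota 0 n) | sorted apart s].

(* The default value of [head] excludes the empty sequence. *)
Definition capped_seqs n : seq (seq nat) :=
  [seq s <- king_seqs n | (head 0 s != 0) && (last 0 s != n.-1)].

(* [a] is the size of [L]; the entry [b] at position [a] is the size of [R], which
   forces the second point to be at position [n - b.+1] with value [n - a.+1].
     *)
Definition occ_at (s : seq nat) (a : nat) : bool :=
  let n := size s in
  let b := nth 0 s a in
  [&& a + b + 1 < n, nth 0 s (n - b.+1) == n - a.+1 &
      all (fun i => [&& (i < a) ==> (n - a <= nth 0 s i),
                        (a < i < n - b.+1) ==> (b < nth 0 s i < n - a.+1) &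
                        (n - b.+1 < i) ==> (nth 0 s i < b)]) (iota 0 n)].

Definition occs (s : seq nat) : nat := count (occ_at s) (iota 0 (size s)).

(* The skew sum L (-) (1 (+) M (+) 1) (-) R. *)
Definition glue (L M R : seq nat) : seq nat :=
  map (addn (size M + 2 + size R)) L ++ size R :: map (addn (size R).+1) M
    ++ (size R + size M).+1 :: R.

(** * King sequences and king skew sums *)

Lemma perm_iotaE n (s : seq nat) :
  perm_eq s (iota 0 n) = [&& size s == n, uniq s & all (fun x => x < n) s].
Proof.
apply/idP/idP => [ps|/and3P[/eqP ss us /allP as_]].
  rewrite (perm_size ps) size_iota eqxx (perm_uniq ps) iota_uniq /=.
  by rewrite (perm_all _ ps); apply/allP => x; rewrite mem_iota.
have sub : {subset s <= iota 0 n} by move=> x /as_; rewrite mem_iota.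
have [|_ eqs] := uniq_min_size us sub; first by rewrite size_iota ss.
by apply: uniq_perm; rewrite ?iota_uniq.
Qed.

Lemma mem_king_seqs n s :
  (s \in king_seqs n) =
  [&& size s == n, uniq s, all (fun x => x < n) s & sorted apart s].
Proof. by rewrite mem_filter mem_permutations perm_iotaE andbC -!andbA. Qed.

Lemma king_seqs_uniq n : uniq (king_seqs n).
Proof. by rewrite filter_uniq // permutations_uniq. Qed.

Lemma size_king_seq n s : s \in king_seqs n -> size s = n.
Proof. by rewrite mem_king_seqs => /andP[/eqP]. Qed.

Lemma apart_addl c : {mono addn c : x y / apart x y}.
Proof. by move=> x y; rewrite /apart; lia. Qed.

Lemma sorted_apart_shift c s : sorted apart (map (addn c) s) = sorted apart s.
Proof. by rewrite sorted_map; apply: eq_sorted => x y /=;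
  rewrite apart_addl. Qed.

Definition edge_to (T : Type) (e : rel T) (s : seq T) (x : T) : bool :=
  if s is y :: s' then e (last y s') x else true.

Definition edge_from (T : Type) (e : rel T) (x : T) (s : seq T) : bool :=
  if s is y :: _ then e x y else true.

Lemma sorted_split (T : Type) (e : rel T) (s t : seq T) (x : T) :
  sorted e (s ++ x :: t) =
  [&& sorted e s, edge_to e s x, edge_from e x t & sorted e t].
Proof.
rewrite sorted_cat_cons; have -> : path e x t = edge_from e x t && sorted e t
  by case: t.
by case: s => [|y s] //=; rewrite rcons_path -!andbA.
Qed.

Lemma shift_uniq c s : uniq (map (addn c) s) = uniq s.
Proof. by rewrite map_inj_uniq //; apply: addnI. Qed.

Definition bounded (s : seq nat) : bool := all (fun x => x < size s) s.

Lemma glue_size L M R : size (glue L M R) = size L + size M + size R + 2.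
Proof. by rewrite /glue !(size_cat, size_map) /= !(size_cat, size_map) /=;
  lia. Qed.

Lemma glue_uniq L M R :
  bounded L -> bounded M ->
  bounded R ->
  uniq (glue L M R) = [&& uniq L, uniq M & uniq R].
Proof.
move=> /allP hL /allP hM /allP hR.
rewrite /glue cat_uniq /= cat_uniq /= !shift_uniq.
have -> : has [in map (addn (size M + 2 + size R)) L] (map (addn (size R).+1) M
  ++ (size R + size M).+1 :: R) = false.
  apply/negbTE/hasPn => x; rewrite mem_cat inE => hx.
  apply/negP => /= /mapP[y yL xy].
  case/orP: hx => [/mapP[z /hM]|/orP[/eqP|/hR]]; lia.
have -> : size R \in map (addn (size M + 2 + size R)) L = false.
  by apply/negbTE/mapP => -[y]; lia.
have -> : (size R \in map (addn (size R).+1) M ++ (size R + size M).+1 :: R) =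
  false.
  apply/negbTE; rewrite mem_cat inE; apply/negP.
  by case/orP=> [/mapP[z /hM]|/orP[/eqP|/hR]]; lia.
have -> : ((size R + size M).+1 \in map (addn (size R).+1) M) = false.
  by apply/negbTE/mapP => -[y /hM]; lia.
have -> : ((size R + size M).+1 \in R) = false.
  by apply/negbTE/negP => /hR; lia.
have -> : has [in map (addn (size R).+1) M] R = false.
  apply/negbTE/hasPn => x /hR xR; apply/negP => /= /mapP[y _]; lia.
by [].
Qed.

Lemma glue_all L M R :
  bounded L -> bounded M ->
  bounded R -> bounded (glue L M R).
Proof.
move=> /allP hL /allP hM /allP hR; apply/allP => x; rewrite glue_size.
rewrite mem_cat inE mem_cat inE.
by case/or4P => [/mapP[z /hL]|/eqP|/mapP[z /hM]|/orP[/eqP|/hR]]; lia.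
Qed.

(** The drops from [L] to the low point and from the high point to [R] are always at least 2. The
    steps from the low point into [M] and from [M] to the high point fail exactly when [M] starts
    with its minimum or ends with its maximum. If [M] is empty, the two points are neighbours with
    consecutive values, in agreement with the default 0 of [head]. *)
Lemma glue_sorted L M R :
  bounded M -> bounded R ->
  sorted apart (glue L M R) =
  [&& sorted apart L, sorted apart M, head 0 M != 0, last 0 M != (size M).-1
    & sorted apart R].
Proof.
move=> hM hR; rewrite /glue sorted_split sorted_split !sorted_apart_shift.
have -> : edge_to apart (map (addn (size M + 2 + size R)) L) (size R).
  by case: L => [|x L] //=; rewrite last_map /apart; lia.
have -> : edge_from apart (size R + size M).+1 R.
  by move: hR; rewrite /bounded; case: R => [|x R] //= /andP[];
    rewrite /apart; lia.
case: M hM => [|x M] hM /=.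
  by rewrite /apart andbF /=; lia.
rewrite last_map /apart.
have := allP hM _ (mem_last x M) => /= hl.
have -> : (size R).+1 < (size R).+1 + x = (x != 0) by lia.
have -> : ((size R).+1 + x).+1 < size R = false by lia.
have -> : ((size R).+1 + last x M).+1 < (size R + (size M).+1).+1 = (last x M
  != size M) by lia.
have -> : (size R + (size M).+1).+2 < (size R).+1 + last x M = false by lia.
by rewrite !orbF; case: (x != 0); rewrite ?andbF //= ; case: (last x M != _);
  rewrite ?andbF.
Qed.

Lemma glue_king L M R :
  bounded L -> bounded M ->
  bounded R ->
  (glue L M R \in king_seqs (size L + size M + size R + 2)) =
  [&& L \in king_seqs (size L), M \in capped_seqs (size M) & R \in king_seqs
    (size R)].
Proof.
move=> hL hM hR; rewrite [M \in _]mem_filter !mem_king_seqs -glue_size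
  -!/(bounded _) glue_all //.
rewrite glue_uniq // glue_sorted // hL hM hR !eqxx /=.
by case: (uniq L); case: (uniq M); case: (uniq R); case: (sorted _ L);
  case: (sorted _ M); case: (sorted _ R); rewrite ?andbF ?andbT //= ?andbF.
Qed.

(** * Entries and occurrences of a skew sum *)

Lemma nth_glue_left L M R i : i < size L ->
  nth 0 (glue L M R) i = size M + 2 + size R + nth 0 L i.
Proof. by move=> h; rewrite nth_cat size_map h (nth_map 0). Qed.

Lemma nth_glue_low L M R : nth 0 (glue L M R) (size L) = size R.
Proof. by rewrite nth_cat size_map ltnn subnn. Qed.

Lemma nth_glue_mid L M R i : i < size M ->
  nth 0 (glue L M R) (size L + i.+1) = (size R).+1 + nth 0 M i.
Proof.
move=> h; rewrite nth_cat size_map ltnNge leq_addr /= addKn /=.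
by rewrite nth_cat size_map h (nth_map 0).
Qed.

Lemma nth_glue_high L M R :
  nth 0 (glue L M R) (size L + (size M).+1) = (size R + size M).+1.
Proof.
by rewrite nth_cat size_map ltnNge leq_addr /= addKn /= nth_cat size_map ltnn
  subnn.
Qed.

Lemma nth_glue_right L M R i :
  nth 0 (glue L M R) (size L + size M + 2 + i) = nth 0 R i.
Proof.
rewrite nth_cat size_map ltnNge -!addnA leq_addr /= addKn.
have -> : size M + (2 + i) = (size M + i.+1).+1 by lia.
by rewrite /= nth_cat size_map ltnNge leq_addr /= addKn.
Qed.

(** [GlueRight] puts no bound on [j]: beyond the end, both sequences return the default 0. *)
Variant glue_index_spec (L M R : seq nat) (i : nat) : nat -> nat -> Prop :=
| GlueLeft of i < size L : glue_index_spec L M R i i (size M + 2 + size R + nth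
  0 L i)
| GlueLow of i = size L : glue_index_spec L M R i i (size R)
| GlueMid j of j < size M & i = size L + j.+1 : glue_index_spec L M R i i
  ((size R).+1 + nth 0 M j)
| GlueHigh of i = size L + (size M).+1 : glue_index_spec L M R i i (size R +
  size M).+1
| GlueRight j of i = size L + size M + 2 + j : glue_index_spec L M R i i (nth 0
  R j).

Lemma glue_indexP L M R i : glue_index_spec L M R i i (nth 0 (glue L M R) i).
Proof.
have [h|h|->] := ltngtP i (size L); last 1 first.
- by rewrite nth_glue_low; constructor.
- by rewrite nth_glue_left //; constructor.
have [h1|h1|h1] := ltngtP i (size L + (size M).+1).
- have hj : i - (size L).+1 < size M by lia.
  have e : i = size L + (i - (size L).+1).+1 by lia.
  by rewrite [in nth _ _ _]e nth_glue_mid //; constructor.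
- have e : i = size L + size M + 2 + (i - (size L + size M + 2)) by lia.
  by rewrite [in nth _ _ _]e nth_glue_right; constructor.
- by rewrite [in nth _ _ _]h1 nth_glue_high; constructor.
Qed.

Lemma glue_occ_at L M R :
  bounded L -> bounded M ->
  bounded R -> occ_at (glue L M R) (size L).
Proof.
move=> /(all_nthP 0) hL /(all_nthP 0) hM /(all_nthP 0) hR;
  rewrite /occ_at nth_glue_low glue_size.
apply/and3P; split; first lia.
  have -> : size L + size M + size R + 2 - (size R).+1 = size L + (size M).+1
    by lia.
  by rewrite nth_glue_high; lia.
apply/allP => i; rewrite mem_iota /= add0n => hi.
case: glue_indexP hi => [h|h|j h e|h|j e] hi; try lia.
- by have := hM _ h; lia.
- have h : j < size R by lia.
  by have := hR _ h; lia.
Qed.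

(* The component that starts at [size L] is skew-indecomposable, so the later
   occurrences all lie inside [R]. *)
Lemma glue_occ_at_block L M R i :
  size L < i < size L + size M + 2 -> occ_at (glue L M R) i = false.
Proof.
move=> hi; apply/negbTE/negP => /and3P[h1 _ /allP /(_ (size L))].
by rewrite mem_iota nth_glue_low; move: h1; rewrite glue_size; lia.
Qed.

(** Passing from [R] to the skew sum raises the size and the position by the same amount, so $n-a$
    is unchanged. The added entries are all at least [size R] and satisfy the clause for entries on
    the left. *)
Lemma glue_occ_at_right L M R j :
  bounded L -> bounded M ->
  bounded R -> j < size R ->
  occ_at (glue L M R) (size L + size M + 2 + j) = occ_at R j.
Proof.
move=> /(all_nthP 0) hL /(all_nthP 0) hM /(all_nthP 0) hR hj;
  rewrite /occ_at nth_glue_right glue_size.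
set b := nth 0 R j; have hb : b < size R by apply: hR.
have -> : size L + size M + size R + 2 - b.+1 = size L + size M + 2 + (size R -
  b.+1) by lia.
rewrite nth_glue_right; congr [&& _, _ & _]; [lia | lia | ].
apply/allP/allP => h i; rewrite mem_iota add0n => /= hi.
  have /h : size L + size M + 2 + i \in iota 0 (size L + size M + size R + 2).
    by rewrite mem_iota; lia.
  by rewrite nth_glue_right; lia.
case: glue_indexP hi => [h'|h'|k h' e|h'|k e] hi; try lia.
- have /h : k \in iota 0 (size R) by rewrite mem_iota; lia.
  lia.
Qed.

Lemma count_occ_after L M R :
  bounded L -> bounded M ->
  bounded R ->
  count (occ_at (glue L M R)) (iota (size L).+1 (size M + size R + 1)) = occs R.
Proof.
move=> hL hM hR; have -> : size M + size R + 1 = (size M).+1 + size R by lia.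
rewrite iotaD count_cat (@eq_in_count _ _ pred0) ?count_pred0; last first.
  by move=> i; rewrite mem_iota => hi; apply: glue_occ_at_block; lia.
have -> : (size L).+1 + (size M).+1 = size L + size M + 2 + 0 by lia.
rewrite add0n iotaDl count_map /occs; apply: eq_in_count => i.
by rewrite mem_iota => hi /=; rewrite glue_occ_at_right.
Qed.

(** * The bijection between marked occurrences and triples of blocks *)

Lemma occ_at_glue n s a : s \in king_seqs n -> occ_at s a ->
  exists L M R, [/\ s = glue L M R, size L = a, size R = nth 0 s a
    & [/\ bounded L, bounded M & bounded R]].
Proof.
rewrite mem_king_seqs => /and4P[/eqP sn _ /(all_nthP 0) hs _].
rewrite /occ_at sn; rewrite sn in hs; set b := nth 0 s a => /and3P[h1 /eqP h2
  /allP h3].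
have memi i : i < n -> i \in iota 0 n by rewrite mem_iota.
have h i hi := h3 i (memi i hi).
pose m := n - (a + b + 2).
have szL : size (take a s) = a by rewrite size_takel ?sn; lia.
have szM : size (take m (drop a.+1 s)) = m.
  by rewrite size_takel // size_drop sn; lia.
have szR : size (drop (n - b) s) = b by rewrite size_drop sn; lia.
have nM i : i < m -> nth 0 (take m (drop a.+1 s)) i = nth 0 s (a.+1 + i).
  by move=> hi; rewrite nth_take // nth_drop.
(* By [h3] and [hs] the values of the three blocks lie in $[n-a,n)$, $(b,n-a-1)$ and $[0,b)$, so the
   truncated subtractions are undone by the shifts in [glue]. *)
exists (map (subn^~ (n - a)) (take a s)), (map (subn^~ b.+1) (take m (drop a.+1
  s))), (drop (n - b) s).
rewrite /glue /bounded !size_map szL szM szR; split=> //; last split.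
- rewrite -!map_comp.
  rewrite [X in X ++ _]map_id_in; last first.
    move=> x /(nthP 0)[i]; rewrite szL => hi <- /=; rewrite nth_take //.
    by have := h i; lia.
  rewrite (@map_id_in _ (addn b.+1 \o _)); last first.
    move=> x /(nthP 0)[i]; rewrite szM => hi <- /=; rewrite nM //.
    by have := h (a.+1 + i); lia.
  rewrite -[LHS](cat_take_drop a) (drop_nth 0) ?sn; last lia.
  congr (_ ++ _ :: _); rewrite -[LHS](cat_take_drop m) drop_drop.
  have -> : m + a.+1 = n - b.+1 by lia.
  rewrite (@drop_nth _ 0 (n - b.+1)) ?sn; last lia.
  by rewrite h2; congr (_ ++ _ :: drop _ _); lia.
- apply/(all_nthP 0) => i; rewrite size_map szL => hi.
  rewrite (nth_map 0) ?szL // nth_take //.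
  have := h i; have := hs i; lia.
- apply/(all_nthP 0) => i; rewrite size_map szM => hi.
  rewrite (nth_map 0) ?szM // nM //.
  have := h (a.+1 + i); lia.
- apply/(all_nthP 0) => i; rewrite szR => hi; rewrite nth_drop.
  have := h (n - b + i); lia.
Qed.

Lemma king_seq_bounded n s : s \in king_seqs n -> bounded s.
Proof. by rewrite mem_king_seqs /bounded => /and4P[/eqP->]. Qed.

Lemma capped_seqs_uniq n : uniq (capped_seqs n).
Proof. exact: filter_uniq (king_seqs_uniq n). Qed.

Lemma mem_capped_seqs n s : s \in capped_seqs n -> s \in king_seqs n.
Proof. by rewrite mem_filter => /andP[]. Qed.

Lemma glue_inj L M R L' M' R' :
  size L = size L' -> size M = size M' -> size R = size R' ->
  glue L M R = glue L' M' R' -> [/\ L = L', M = M' & R = R'].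
Proof.
move=> sL sM sR /eqP; rewrite /glue -sM -sR eqseq_cat ?size_map // eqseq_cons.
rewrite eqseq_cat ?size_map // eqseq_cons.
case/and5P=> /eqP eL _ /eqP eM _ /eqP eR.
by split=> //; [apply: inj_map eL | apply: inj_map eM]; apply: addnI.
Qed.

Definition glue_triple (y : seq nat * seq nat * seq nat) := glue y.1.1 y.1.2
  y.2.

Definition glue_triples a m b :=
  [seq (x, R) | x <- [seq (L, M) | L <- king_seqs a, M <- capped_seqs m],
                R <- king_seqs b].

Lemma mem_glue_triples a m b L M R :
  ((L, M, R) \in glue_triples a m b) =
  [&& L \in king_seqs a, M \in capped_seqs m & R \in king_seqs b].
Proof.
apply/allpairsP/and3P => [[[[L' M'] R'] /= [/allpairsP[[L1 M1] /= [hL hM e1]]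
  hR e]]|[hL hM hR]].
  by case: e1 e => -> -> [-> -> ->].
exists ((L, M), R); split=> //=; apply/allpairsP; by exists (L, M).
Qed.

Lemma perm_glue a m b :
  perm_eq [seq s <- king_seqs (a + m + b + 2) | occ_at s a && (nth 0 s a == b)]
          (map glue_triple (glue_triples a m b)).
Proof.
apply: uniq_perm.
- by rewrite filter_uniq // king_seqs_uniq.
- rewrite map_inj_in_uniq; last first.
    move=> [[L M] R] [[L' M'] R']; rewrite !mem_glue_triples.
    move=> /and3P[hL /mem_capped_seqs hM hR] /and3P[hL' /mem_capped_seqs hM'
      hR'].
    rewrite /glue_triple /= => /glue_inj[]; rewrite ?(size_king_seq hL)
      ?(size_king_seq hM) ?(size_king_seq hR).
    + by rewrite (size_king_seq hL').
    + by rewrite (size_king_seq hM').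
    + by rewrite (size_king_seq hR').
    by move=> -> -> ->.
  apply: allpairs_uniq; [|exact: king_seqs_uniq|by move=> [? ?] [? ?] _ _ [->
    ->]].
  apply: allpairs_uniq; [exact: king_seqs_uniq|exact: capped_seqs_uniq|by
    move=> [? ?] [? ?] _ _ [-> ->]].
move=> s; rewrite mem_filter; apply/andP/mapP => [[/andP[oc /eqP sa] ks]|].
  have [L [M [R [es sL sR [bL bM bR]]]]] := occ_at_glue ks oc.
  exists (L, M, R) => //; rewrite mem_glue_triples.
  have sM : size M = m.
    by have := size_king_seq ks; rewrite es glue_size sL sR sa; lia.
  by move: ks; rewrite es -sL -sM -sa -sR glue_king // sL sM sR sa.
case=> -[[L M] R]; rewrite mem_glue_triples => /and3P[hL hM hR] ->.
have hM' := mem_capped_seqs hM.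
have [bL bM bR] := And3 (king_seq_bounded hL) (king_seq_bounded hM')
  (king_seq_bounded hR).
rewrite -(size_king_seq hL) -(size_king_seq hM') -(size_king_seq hR)
  /glue_triple /=.
rewrite glue_occ_at // nth_glue_low eqxx glue_king //.
by rewrite (size_king_seq hL) (size_king_seq hM') (size_king_seq hR) hL hM hR.
Qed.

(** * Stripping an initial minimum and a final maximum *)

(* Unlike in [capped_seqs], the default value of [head] keeps the empty sequence. *)
Definition headed_seqs n : seq (seq nat) := [seq s <- king_seqs n | head 1 s !=
  0].

Lemma headed_seqs_uniq n : uniq (headed_seqs n).
Proof. exact: filter_uniq (king_seqs_uniq n). Qed.

Lemma cons_king n s : (0 :: map (addn 1) s \in king_seqs n.+1) = (s \in
  headed_seqs n).
Proof.
rewrite [RHS]mem_filter !mem_king_seqs.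
rewrite /= size_map eqSS map_inj_uniq; last exact: addnI.
have -> : 0 \in map (addn 1) s = false by apply/negbTE/mapP => -[].
rewrite all_map; have -> : all (preim (addn 1) (fun x => x < n.+1)) s = all
  (fun x => x < n) s.
  by apply: eq_all => x /=; lia.
rewrite /=; case: (_ == _) => /=; rewrite ?andbF //; case: (uniq s);
  rewrite ?andbF //=.
case: (all _ s); rewrite ?andbF //=; case: s => //= x s.
rewrite -[path _ _ _]/(sorted apart (map (addn 1) (x :: s))) sorted_apart_shift
  /=.
by congr (_ && _); rewrite /apart; lia.
Qed.

(** A king permutation either avoids starting with 0, or is 0 followed by a shifted king
    permutation. In the latter case the remainder may not start with its own minimum, which would be
    adjacent to 0 in value. *)
Lemma size_king_seqs_rec n :
  size (king_seqs n.+1) = size (headed_seqs n.+1) + size (headed_seqs n).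
Proof.
rewrite -(count_predC (fun s => head 1 s != 0)) -size_filter; congr (_ + _).
rewrite -size_filter -[RHS](size_map (fun s => 0 :: map (addn 1) s)).
apply/perm_size/uniq_perm.
- by rewrite filter_uniq // king_seqs_uniq.
- rewrite map_inj_uniq ?headed_seqs_uniq //.
  by move=> s t [] /inj_map; apply; apply: addnI.
move=> t; rewrite mem_filter /= negbK; apply/andP/mapP => [[]|[s hs ->]];
  last first.
  by rewrite cons_king hs.
case: t => [|x t] //= /eqP-> ht.
(* The entry 0 is already used by the head, so [predn] is undone on [t]. *)
have e : t = map (addn 1) (map predn t).
  rewrite -map_comp map_id_in // => -[|x'] //= xt.
  by move: ht; rewrite mem_king_seqs /= xt andbF.
by exists (map predn t); rewrite -?cons_king -e.
Qed.

(** For empty [s] both sides fail: the one-entry permutation starts with its minimum. This is why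
    [capped_seqs] has to exclude the empty sequence. *)
Lemma rcons_king n s : (rcons s n \in headed_seqs n.+1) = (s \in capped_seqs n).
Proof.
rewrite [LHS]mem_filter [RHS]mem_filter !mem_king_seqs size_rcons eqSS
  rcons_uniq all_rcons ltnSn /=.
rewrite -cats1 sorted_split /= andbT.
case: s => [|x s] /=; first by case: n.
apply/and4P/and3P => [[x0 sn /andP[nns /andP[xns us]] /and3P[h p e]]|[/andP[x0
  l] sn /and3P[/andP[xns us] h p]]].
- have h' : all (fun y => y < n) (x :: s).
    apply/allP => y ys; have /= := allP (h : all (fun y => y < n.+1) (x :: s))
      y ys.
    by have : y != n by [apply: contraNneq nns => <-]; lia.
  have := allP h' _ (mem_last x s) => /= hl; rewrite x0 sn xns us p.
  by move: h' => /= ->; split=> //; move: e; rewrite /apart; lia.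
- have {}h : all (fun y => y < n) (x :: s) := h.
  have hl := allP h _ (mem_last x s); rewrite /= in hl.
  rewrite x0 sn xns us p; split=> //.
    by rewrite !andbT; apply/negP => ns; have := allP h n ns; rewrite ltnn.
  rewrite /=; apply/andP; split; last by rewrite /apart; lia.
  by apply/andP; split; [move: h => /=|apply/allP => y ys; have := allP h y;
    rewrite inE ys orbT]; lia.
Qed.

Lemma size_headed_seqs_rec n :
  size (headed_seqs n.+1) = size (capped_seqs n.+1) + size (capped_seqs n).
Proof.
rewrite -(count_predC (fun s => last 0 s != n)) -!size_filter -filter_predI.
congr (_ + _).
  congr size; apply: eq_in_filter => s /=; rewrite andbC.
  by move/size_king_seq; case: s.
rewrite -[RHS](size_map (rcons^~ n)); apply/perm_size/uniq_perm.
- by rewrite filter_uniq // headed_seqs_uniq.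
- rewrite map_inj_uniq ?capped_seqs_uniq //.
  by move=> s t /rcons_inj[].
move=> t; rewrite mem_filter /= negbK; apply/andP/mapP => [[]|[s hs ->]];
  last first.
  by rewrite last_rcons rcons_king hs.
case/lastP: t => [|s x]; first by rewrite mem_filter mem_king_seqs andbF.
by rewrite last_rcons => /eqP->; rewrite rcons_king; exists s.
Qed.

Local Open Scope ring_scope.

(** * The functional equation *)

Section GeneratingFunctions.
Variable R : comNzRingType.
Implicit Types (f g : fps R) (u : R).

Lemma fcoefD f g n : fcoef (f + g) n = fcoef f n + fcoef g n.
Proof. by []. Qed.

Lemma fcoefXM f n : fcoef (fpsX * f) n = if n is k.+1 then fcoef f k else 0.
Proof.
rewrite fcoefM; case: n => [|n]; first by rewrite big_ord1 mul0r.
rewrite big_ord_recl mul0r add0r big_ord_recl /= mul1r subSS subn0 big1 ?addr0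
  //.
by move=> i _; rewrite mul0r.
Qed.

Lemma fcoefCM (c : R) f n : fcoef (fpsC c * f) n = c * fcoef f n.
Proof.
rewrite fcoefM big_ord_recl /= subn0 big1 ?addr0 // => i _; exact: mul0r.
Qed.

Definition king_gf : fps R := Fps (fun n => (size (king_seqs n))%:R).
Definition headed_gf : fps R := Fps (fun n => (size (headed_seqs n))%:R).
Definition capped_gf : fps R := Fps (fun n => (size (capped_seqs n))%:R).
Definition occ_gf u : fps R := Fps (fun n => \sum_(s <- king_seqs n) u ^+ occs
  s).

Lemma king_gf_headed : king_gf = (1 + fpsX) * headed_gf.
Proof.
apply/fpsP => n; rewrite mulrDl mul1r fcoefD fcoefXM.
by case: n => [|n] /=; rewrite ?addr0 // size_king_seqs_rec natrD.
Qed.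

(** The summand 1 is the empty permutation, which is headed but neither capped nor obtained by
    appending a maximum. *)
Lemma headed_gf_capped : headed_gf = 1 + (1 + fpsX) * capped_gf.
Proof.
apply/fpsP => n; rewrite mulrDl mul1r !fcoefD fcoefXM fcoef1.
by case: n => [|n] /=; rewrite ?addr0 ?add0r // size_headed_seqs_rec natrD.
Qed.

Lemma capped_gfE : (1 + fpsX) ^+ 2 * capped_gf = king_gf - fpsX - 1.
Proof. by rewrite king_gf_headed headed_gf_capped; ring. Qed.

(** A finite geometric sum whose terms are indexed by the marked positions: the exponent at [a] is
    the number of marks after [a], and runs from $p-1$ down to 0. *)
Lemma expr_count u (P : pred nat) m n :
  u ^+ count P (iota m n) - 1 =
  (u - 1) * \sum_(a <- iota m n | P a) u ^+ count P (iota a.+1 (m + n - a.+1)).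
Proof.
elim: n m => [|n IH] m /=; first by rewrite big_nil mulr0 subrr.
rewrite big_cons addnS -addSn; case: (P m); rewrite ?add0n -?IH //=.
by rewrite mulrDr -IH addKn exprS; ring.
Qed.

Lemma sum_glue u a m b :
  \sum_(s <- king_seqs (a + m + b + 2) | occ_at s a && (nth 0%N s a == b))
     u ^+ count (occ_at s) (iota a.+1 (m + b + 1)) =
  fcoef king_gf a * (fcoef capped_gf m * fcoef (occ_gf u) b).
Proof.
rewrite -big_filter (perm_big _ (perm_glue a m b)) big_map !big_allpairs.
rewrite (eq_big_seq (fun=> fcoef capped_gf m * fcoef (occ_gf u) b)) /=.
  by rewrite big_const_seq count_predT iter_addr_0; exact: esym (mulr_natl _ _).
move=> L hL; rewrite (eq_big_seq (fun=> fcoef (occ_gf u) b)) /=.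
  by rewrite big_const_seq count_predT iter_addr_0; exact: esym (mulr_natl _ _).
move=> M /mem_capped_seqs hM; apply: eq_big_seq => S hS; congr (_ ^+ _).
rewrite -(size_king_seq hL) -(size_king_seq hM) -(size_king_seq hS).
by apply: count_occ_after; apply: king_seq_bounded; eassumption.
Qed.

Lemma occ_at_bound s a : occ_at s a -> (a + nth 0%N s a + 1 < size s)%N.
Proof. by case/andP. Qed.

(** Expand each $u^p-1$ by [expr_count], exchange the sums, and group the marked occurrences by the
    sizes of $L$ and $M$; the size of $R$ is what remains. The index drops by two for the two points
    of the occurrence. *)
Lemma occ_gf_coef u n :
  fcoef (occ_gf u) n = fcoef king_gf n + (u - 1) *
  (if n is k.+2 then fcoef (king_gf * (capped_gf * occ_gf u)) k else 0).
Proof.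
transitivity (fcoef king_gf n + (u - 1) * \sum_(a <- iota 0 n)
    \sum_(s <- king_seqs n | occ_at s a) u ^+ count (occ_at s) (iota a.+1 (n -
      a.+1))).
  rewrite (exchange_big_dep xpredT) // mulr_sumr.
  have -> : fcoef king_gf n = \sum_(s <- king_seqs n) 1.
    by rewrite big_const_seq count_predT iter_addr_0.
  rewrite -big_split.
  apply: eq_big_seq => s ks; rewrite /occs (size_king_seq ks) /=.
  by rewrite -[u ^+ _](subrK 1) expr_count addrC add0n.
congr (_ + _ * _).
(* The first point needs a second one to its right, so it is never at the last position. *)
have zero a : (n < a + 2)%N -> \sum_(s <- king_seqs n | occ_at s a) u ^+ count
  (occ_at s) (iota a.+1 (n - a.+1)) = 0.
  move=> an; rewrite big1_seq // => s /andP[/occ_at_bound h ks].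
  by rewrite (size_king_seq ks) in h; lia.
case: n zero => [|[|k]] zero; first by rewrite big_nil.
  by rewrite big_seq1 zero.
have -> : iota 0 k.+2 = index_iota 0 k.+1 ++ [:: k.+1].
  by rewrite -[k.+2]addn1 iotaD /index_iota subn0.
rewrite big_cat big_seq1 (zero k.+1); last lia.
rewrite [LHS]addr0 big_mkord.
rewrite fcoefM; apply: eq_bigr => a _; rewrite fcoefM mulr_sumr.
have ak : (a <= k)%N by rewrite -ltnS.
(* Here [m] is the size of $M$. [inord] only provides a finite index type; by [occ_at_bound] its
   argument is in range and the inner subtraction is exact. *)
rewrite (partition_big (fun s => inord (k - a - nth 0%N s a) : 'I_(k - a).+1)
  xpredT) //=.
apply: eq_bigr => m _; rewrite -sum_glue.
have mk : (m <= k - a)%N by rewrite -ltnS.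
have -> : (a + m + (k - a - m) + 2 = k.+2)%N by lia.
have -> : (m + (k - a - m) + 1 = k.+2 - a.+1)%N by lia.
rewrite [LHS]big_seq_cond [RHS]big_seq_cond; apply: eq_bigl => s.
case ks: (s \in _) => //=; case oc: (occ_at s a) => //=.
have := occ_at_bound oc; rewrite (size_king_seq ks) => h.
rewrite -val_eqE /= inordK; lia.
Qed.

Lemma occ_gf_rec u :
  occ_gf u = king_gf +
    fpsC (u - 1) * (fpsX * (fpsX * (king_gf * (capped_gf * occ_gf u)))).
Proof.
apply/fpsP => n; rewrite fcoefD fcoefCM occ_gf_coef; congr (_ + _ * _).
by rewrite fcoefXM; case: n => // n; rewrite fcoefXM; case: n.
Qed.

Lemma fpsCB1 u : fpsC (u - 1) = fpsC u - 1.
Proof. by apply/fpsP => -[|n] //=; rewrite subr0. Qed.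

Lemma occ_gf_eq u :
  occ_gf u * ((1 + fpsX) ^+ 2 +
      (1 - fpsC u) * (fpsX ^+ 2 * (king_gf - fpsX - 1) * king_gf)) =
  (1 + fpsX) ^+ 2 * king_gf.
Proof.
rewrite -capped_gfE; have := occ_gf_rec u; rewrite fpsCB1.
set E := occ_gf u; move=> eE.
have : king_gf = E - (fpsC u - 1) * (fpsX * (fpsX * (king_gf * (capped_gf *
  E)))).
  by rewrite {1}eE addrK.
(* With $A-t-1$ already replaced by $(1+t)^2B$, expanding the single $A$ on the right makes the two
   sides agree as polynomials. *)
move=> eA; rewrite [in RHS]eA; ring.
Qed.


End GeneratingFunctions.

Local Open Scope nat_scope.

(** * From sequences back to permutations *)

Definition one_line n (s : 'S_n) : seq nat := [seq val (s i) | i <- enum 'I_n].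

Lemma size_one_line n (s : 'S_n) : size (one_line s) = n.
Proof. by rewrite size_map size_enum_ord. Qed.

Lemma nth_one_line n (s : 'S_n) (i : 'I_n) : nth 0 (one_line s) i = s i.
Proof. by rewrite (nth_map i) ?size_enum_ord // nth_ord_enum. Qed.

Lemma one_line_inj n : injective (@one_line n).
Proof.
move=> s t e; apply/permP => i; apply: val_inj.
by rewrite /= -!nth_one_line e.
Qed.

Lemma one_line_king n (s : 'S_n) : (one_line s \in king_seqs n) = king s.
Proof.
rewrite mem_king_seqs size_one_line eqxx map_inj_uniq ?enum_uniq; last first.
  by move=> i j /val_inj /perm_inj.
rewrite all_map; have -> /= : all (preim (fun i => val (s i)) (fun x => x < n))
  (enum 'I_n).
  by apply/allP => i _ /=.
apply/(sortedP 0)/forallP => [h i|h i]; rewrite ?size_one_line.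
  apply/forallP => j; apply/implyP => /eqP ij.
  have := h i; rewrite -ij size_one_line !nth_one_line ltn_ord => /(_ isT).
  by rewrite /apart; lia.
move=> hi; have hi' := ltnW hi.
have /forallP /(_ (Ordinal hi)) /implyP /(_ (eqxx _)) := h (Ordinal hi').
by rewrite -(nth_one_line s (Ordinal hi)) -(nth_one_line s (Ordinal hi'))
  /apart /=; lia.
Qed.

Lemma one_line_surj n x : x \in king_seqs n -> exists s : 'S_n, one_line s = x.
Proof.
rewrite mem_king_seqs => /and4P[/eqP sx ux /(all_nthP 0) bx _].
rewrite sx in bx.
pose f (i : 'I_n) : 'I_n := Ordinal (bx i (ltn_ord i)).
have f_inj : injective f.
  move=> i j [] /eqP; rewrite nth_uniq ?sx // => /eqP; exact: val_inj.
exists (perm f_inj); apply: (@eq_from_nth _ 0);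
  rewrite size_one_line ?sx // => i hi.
by rewrite (nth_one_line _ (Ordinal hi)) permE.
Qed.

Lemma perm_one_line n : perm_eq (map (@one_line n) (enum (kings n))) (king_seqs
  n).
Proof.
apply: uniq_perm.
- by rewrite map_inj_uniq ?enum_uniq //; apply: one_line_inj.
- exact: king_seqs_uniq.
move=> x; apply/mapP/idP => [[s]|kx].
  by rewrite mem_enum inE -one_line_king => ? ->.
have [s es] := one_line_surj kx; exists s => //.
by rewrite mem_enum inE -one_line_king es.
Qed.

Lemma card_kings n : #|kings n| = size (king_seqs n).
Proof. by rewrite cardE -(perm_size (perm_one_line n)) size_map. Qed.

Lemma sum_kings (R : nmodType) n (F : seq nat -> R) :
  (\sum_(s in kings n) F (one_line s) = \sum_(x <- king_seqs n) F x)%R.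
Proof. by rewrite -(perm_big _ (perm_one_line n)) big_map big_enum. Qed.

(** * Occurrences of the mesh pattern *)

Lemma card_ord_lt n c : c <= n -> #|[set j : 'I_n | j < c]| = c.
Proof.
move=> cn; have wi : injective (widen_ord cn) by move=> i j [] /val_inj.
rewrite -[RHS]card_ord -cardsT -(card_imset _ wi).
apply: eq_card => j; rewrite inE; apply/idP/imsetP => [jc|[i _ ->]];
  last exact: (ltn_ord i).
by exists (Ordinal jc); rewrite ?inE //; apply: val_inj.
Qed.

Lemma card_ord_ge n c : c <= n -> #|~: [set j : 'I_n | j < c]| = n - c.
Proof. by move=> cn; rewrite cardsCs setCK card_ord card_ord_lt. Qed.

Lemma card_perm_lt n (s : 'S_n) c : c <= n -> #|[set j : 'I_n | s j < c]| = c.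
Proof.
move=> cn; have -> : [set j | s j < c] = s @^-1: [set j : 'I_n | j < c].
  by apply/setP => j; rewrite !inE.
by rewrite card_preimset ?card_ord_lt //; apply: perm_inj.
Qed.

Lemma forall_mesh_p (P : nat -> nat -> bool) :
  [forall b in mesh_p, P (val b.1) (val b.2)] =
  [&& P 0 0, P 0 1, P 1 0, P 1 2, P 2 1 & P 2 2].
Proof.
apply/forall_inP/idP => [h|].
  have g (x y : 'I_3) : (val x, val y) \in [:: (0, 0); (0, 1); (1, 0); (1, 2);
    (2, 1); (2, 2)] -> P x y.
    by move=> xy; apply: (h (x, y)); rewrite inE.
  rewrite (g (@Ordinal 3 0 isT) (@Ordinal 3 0 isT)) // (g (@Ordinal 3 0 isT)
    (@Ordinal 3 1 isT)) //.
  rewrite (g (@Ordinal 3 1 isT) (@Ordinal 3 0 isT)) // (g (@Ordinal 3 1 isT)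
    (@Ordinal 3 2 isT)) //.
  by rewrite (g (@Ordinal 3 2 isT) (@Ordinal 3 1 isT)) // (g (@Ordinal 3 2 isT)
    (@Ordinal 3 2 isT)).
case/and5P=> h1 h2 h3 h4 /andP[h5 h6] [x y] /=; rewrite !inE /=.
by case/or4P=> [||| /or3P[]] /eqP[-> ->].
Qed.

(** Each column has two shaded boxes, leaving one range of values; injectivity of [s] rules out the
    grid lines themselves. *)
Lemma occurrence12_mesh_pP n (s : 'S_n) (i1 i2 : 'I_n) :
  reflect [/\ i1 < i2, s i1 < s i2, forall m : 'I_n, m < i1 -> s i2 < s m,
              forall m : 'I_n, i1 < m < i2 -> s i1 < s m < s i2
            & forall m : 'I_n, i2 < m -> s m < s i1]
          (occurrence12 mesh_p s (i1, i2)).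
Proof.
have neq (i j : 'I_n) : (i : nat) <> j -> (s i : nat) <> s j.
  by move=> ij /val_inj /perm_inj e; apply: ij; rewrite e.
rewrite /occurrence12 (forall_mesh_p (fun x y => [forall m, ~~ in_box s i1 i2 x
  y m])) /=.
apply: (iffP and3P) => [[h1 h2 /and5P[/forallP b1 /forallP b2 /forallP b3
  /forallP b4 /andP[/forallP b5 /forallP b6]]]|[h1 h2 h3 h4 h5]].
  split=> // m hm; have := neq m i1; have := neq m i2; have := ltn_ord m;
    have := ltn_ord (s m).
  - by have := b1 m; have := b2 m; rewrite /in_box /gridline /=; lia.
  - by have := b3 m; have := b4 m; rewrite /in_box /gridline /=; lia.
  - by have := b5 m; have := b6 m; rewrite /in_box /gridline /=; lia.
split=> //; apply/and5P; split; last (apply/andP; split); apply/forallP => m;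
  rewrite /in_box /gridline /=; have := h3 m; have := h4 m; have := h5 m; lia.
Qed.

(* Counting the values below [s i1] and above [s i2] determines [s i1] and
   [s i2] from the positions [i2] and [i1]. *)
Lemma occurrence12E n (s : 'S_n) (i : 'I_n * 'I_n) :
  occurrence12 mesh_p s i = occ_at (one_line s) i.1 && (i.2 == rev_ord (s i.1)).
Proof.
case: i => i1 i2; apply/occurrence12_mesh_pP/andP => /=.
  move=> [h1 h2 h3 h4 h5].
  have e1 : s i1 = n - i2.+1 :> nat.
    rewrite -(card_perm_lt s (ltnW (ltn_ord (s i1)))).
    have -> : [set j | s j < s i1] = ~: [set j : 'I_n | j < i2.+1].
      apply/setP => j; rewrite !inE -leqNgt.
      have [->|ji1] := eqVneq j i1; first by lia.
      have [->|ji2] := eqVneq j i2; first by lia.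
      rewrite -val_eqE /= in ji1; rewrite -val_eqE /= in ji2.
      by have := h3 j; have := h4 j; have := h5 j; lia.
    exact: (card_ord_ge (ltn_ord i2)).
  have e2 : s i2 = n - i1.+1 :> nat.
    have : #|[set j | s j < (s i2).+1]| = (s i2).+1 by apply: card_perm_lt.
    have -> : [set j | s j < (s i2).+1] = ~: [set j : 'I_n | j < i1].
      apply/setP => j; rewrite !inE -leqNgt.
      have [->|ji1] := eqVneq j i1; first by lia.
      have [->|ji2] := eqVneq j i2; first by lia.
      rewrite -val_eqE /= in ji1; rewrite -val_eqE /= in ji2.
      by have := h3 j; have := h4 j; have := h5 j; lia.
    by rewrite (card_ord_ge (ltnW (ltn_ord i1))); lia.
  have i2n := ltn_ord i2; have i1n := ltn_ord i1.
  have e3 : i2 = n - (s i1).+1 :> nat by lia.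
  split; last by rewrite -val_eqE /= e3.
  rewrite /occ_at size_one_line nth_one_line -e3 nth_one_line.
  apply/and3P; split; [lia | lia |].
  apply/allP => m; rewrite mem_iota add0n => /= hm.
  rewrite -[m]/(val (Ordinal hm)) nth_one_line.
  by have := h3 (Ordinal hm); have := h4 (Ordinal hm);
    have := h5 (Ordinal hm) => /=; lia.
move=> [/and3P[h1 h2 /allP h3] /eqP ei2]; move: h1 h2 h3.
rewrite size_one_line nth_one_line => h1.
have e2 : n - (s i1).+1 = i2 by rewrite ei2.
rewrite e2 nth_one_line => /eqP h2 h3.
have h (m : 'I_n) := h3 m; split; try lia.
all: move=> m hm; have := h m; rewrite mem_iota nth_one_line;
  have := ltn_ord m; lia.
Qed.

Lemma occ12E n (s : 'S_n) : occ12 mesh_p s = occs (one_line s).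
Proof.
transitivity #|[set i : 'I_n | occ_at (one_line s) i]|.
  rewrite -(@card_imset _ _ (fun i => (i, rev_ord (s i))));
    last by move=> i j [].
  apply: eq_card => -[i1 i2]; rewrite inE occurrence12E /=.
  apply/andP/imsetP => [[oc /eqP->]|[i]]; first by exists i1; rewrite ?inE.
  by rewrite inE => oc [-> ->].
rewrite /occs [in iota _ _]size_one_line -val_enum_ord count_map cardsE cardE.
by rewrite size_filter -enumT.
Qed.

(** * Numbers of small king permutations *)

(* Prunes the search, so that the kernel can count the king permutations. *)
Fixpoint king_paths (k : nat) (s : seq nat) (x : nat) : nat :=
  if k is k'.+1 then
    sumn [seq if apart x y then king_paths k' (rem y s) y else 0 | y <- s]
  else 1.

Lemma king_pathsE k s x : size s = k -> uniq s ->
  count (path apart x) (permutations s) = king_paths k s x.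
Proof.
elim: k s x => [|k IH] s x; first by case: s.
move=> sk us; rewrite (seq.permP (permutationsE _)) ?sk // undup_id //.
rewrite count_flatten -map_comp /=; congr sumn; apply/eq_in_map => y ys /=.
rewrite count_map; case: ifP => xy.
  rewrite -IH ?rem_uniq // ?size_rem ?sk //.
  by apply: eq_count => t /=; rewrite xy.
by rewrite -[RHS](count_pred0 (permutations (rem y s)));
  apply: eq_count => t /=; rewrite xy.
Qed.

Definition king_count n : nat :=
  if n is k.+1 then sumn [seq king_paths k (rem y (iota 0 n)) y | y <- iota 0 n]
  else 1.

Lemma size_king_seqsE n : size (king_seqs n) = king_count n.
Proof.
case: n => [|n] //; rewrite size_filter (seq.permP (permutationsE _))
  ?size_iota //.
rewrite undup_id ?iota_uniq // count_flatten -map_comp.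
congr sumn; apply/eq_in_map => y ys.
by rewrite [LHS]count_map -king_pathsE ?rem_uniq ?iota_uniq ?size_rem
  ?size_iota.
Qed.

Definition king_numbers : seq nat := [:: 1; 1; 0; 0; 2; 14; 90; 646; 5242].

Lemma size_king_seqs_lt9 n : n < 9 -> size (king_seqs n) = nth 0 king_numbers n.
Proof. by rewrite size_king_seqsE; do 9?[case: n => [|n]; first by lazy]. Qed.

Local Open Scope ring_scope.

(** * Identification of the three series *)

Lemma gfA_king_gf (R : comNzRingType) : gfA R = king_gf R.
Proof. by apply/fpsP => n; rewrite /= card_kings. Qed.

Lemma gfE_occ_gf : gfE = occ_gf 'X.
Proof.
apply/fpsP => n; rewrite /= -sum_kings.
by apply: eq_bigr => s _; rewrite occ12E.
Qed.

(** At $u=0$ the weight $0^p$ is the indicator of $p=0$, as $0^0=1$. *)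
Lemma gfP_occ_gf : gfP = occ_gf (0 : int).
Proof.
apply/fpsP => n; rewrite /= -(sum_kings n (fun x => 0 ^+ occs x)) -sum1_card
  natr_sum.
rewrite [RHS](bigID (fun s => occ12 mesh_p s == 0%N)) /= [X in _ + X]big1
  ?addr0.
  apply: eq_big => s; first by rewrite inE.
  by rewrite inE occ12E => /andP[_ /eqP->].
by move=> s /andP[_]; rewrite occ12E expr0n => /negPf->.
Qed.

Lemma fps_eq_div (R : comUnitRingType) (f g h : fps R) :
  fcoef h 0 = 1 -> f * h = g -> f = g / h.
Proof. by move=> h0 <-; rewrite mulrK // fps_unitE h0 unitr1. Qed.

(** * Initial terms *)

Section LowOrder.
Variables (R : comNzRingType) (f g : fps R).
Hypothesis g_low : forall i, (i < 4)%N -> fcoef g i = 0.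

Lemma fcoefM_low i : (i < 4)%N -> fcoef (f * g) i = 0.
Proof.
move=> i4; rewrite fcoefM big1 // => j _; rewrite g_low ?mulr0 //.
by rewrite (leq_ltn_trans (leq_subr _ _)).
Qed.

Lemma fcoefM4 : fcoef (f * g) 4 = fcoef f 0 * fcoef g 4.
Proof.
have [g0 g1 g2 g3] := And4 (@g_low 0 isT) (@g_low 1 isT) (@g_low 2 isT) (@g_low
  3 isT).
by rewrite mulrC fcoefM !big_ord_recl big_ord0 /= /bump /= g0 g1 g2 g3; ring.
Qed.

Lemma fcoefM5 : fcoef (f * g) 5 = fcoef f 0 * fcoef g 5 + fcoef f 1 * fcoef g 4.
Proof.
have [g0 g1 g2 g3] := And4 (@g_low 0 isT) (@g_low 1 isT) (@g_low 2 isT) (@g_low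
  3 isT).
by rewrite mulrC fcoefM !big_ord_recl big_ord0 /= /bump /= g0 g1 g2 g3; ring.
Qed.

Lemma fcoefM6 :
  fcoef (f * g) 6 =
  fcoef f 0 * fcoef g 6 + fcoef f 1 * fcoef g 5 + fcoef f 2 * fcoef g 4.
Proof.
have [g0 g1 g2 g3] := And4 (@g_low 0 isT) (@g_low 1 isT) (@g_low 2 isT) (@g_low
  3 isT).
by rewrite mulrC fcoefM !big_ord_recl big_ord0 /= /bump /= g0 g1 g2 g3; ring.
Qed.

End LowOrder.

Definition capped_numbers : seq nat := [:: 0; 0; 0; 0; 2; 10; 68]%N.

(** The coefficient form of $(1+t)^2B=A-t-1$ from degree 2 on, used to compute [capped_numbers] from
    [king_numbers]. *)
Lemma size_capped_seqs_rec n :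
  (size (capped_seqs n.+2) + 2 * size (capped_seqs n.+1) + size (capped_seqs n)
    =
   size (king_seqs n.+2))%N.
Proof. by rewrite size_king_seqs_rec !size_headed_seqs_rec; lia. Qed.

Lemma size_capped_seqs_lt7 n :
  (n < 7)%N -> size (capped_seqs n) = nth 0%N capped_numbers n.
Proof.
have c0 : size (capped_seqs 0) = 0%N by [].
have c1 : size (capped_seqs 1) = 0%N by [].
have step m c c' c'' : (m < 7)%N -> size (capped_seqs m) = c ->
    size (capped_seqs m.+1) = c' -> (c'' + 2 * c' + c = nth 0 king_numbers
      m.+2)%N ->
    size (capped_seqs m.+2) = c''.
  by move=> m7 <- <-; rewrite -size_king_seqs_lt9 // -size_capped_seqs_rec; lia.
have c2 : size (capped_seqs 2) = 0%N by apply: step c0 c1 _.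
have c3 : size (capped_seqs 3) = 0%N by apply: step c1 c2 _.
have c4 : size (capped_seqs 4) = 2%N by apply: step c2 c3 _.
have c5 : size (capped_seqs 5) = 10%N by apply: step c3 c4 _.
have c6 : size (capped_seqs 6) = 68%N by apply: step c4 c5 _.
by case: n => [|[|[|[|[|[|[|n]]]]]]] // _; rewrite (c2, c3, c4, c5, c6).
Qed.

Lemma occ_gf_upto8 (R : comNzRingType) (u : R) :
  [seq fcoef (occ_gf u) n | n <- iota 0 9] =
  [:: 1; 1; 0; 0; 2; 14; 88 + 2 * u; 632 + 14 * u; 5152 + 90 * u].
Proof.
have kE n : (n < 9)%N -> fcoef (king_gf R) n = (nth 0%N king_numbers n)%:R.
  by move/size_king_seqs_lt9 <-.
have cE n : (n < 7)%N -> fcoef (capped_gf R) n = (nth 0%N capped_numbers n)%:R.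
  by move/size_capped_seqs_lt7 <-.
have eE := occ_gf_coef u.
set A := king_gf R in kE eE; set B := capped_gf R in cE eE;
  set E := occ_gf u in eE *.
(* The block $M$ has at least 4 entries, so up to degree 8 the correction term involves only the
   coefficients of [A] and [E] up to degree 2. *)
have B_low i : (i < 4)%N -> fcoef B i = 0.
  by move=> i4; rewrite cE; [case: i i4 => [|[|[|[|]]]] | lia].
have EB_low i : (i < 4)%N -> fcoef (B * E) i = 0.
  by rewrite mulrC; apply: fcoefM_low.
have ABE_low i : (i < 4)%N -> fcoef (A * (B * E)) i = 0.
  by apply: fcoefM_low.
have e0 : fcoef E 0 = 1 by rewrite eE kE // /=; ring.
have e1 : fcoef E 1 = 1 by rewrite eE kE // /=; ring.
have e2 : fcoef E 2 = 0 by rewrite eE kE // ABE_low // /=; ring.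
have e3 : fcoef E 3 = 0 by rewrite eE kE // ABE_low // /=; ring.
have e4 : fcoef E 4 = 2 by rewrite eE kE // ABE_low // /=; ring.
have e5 : fcoef E 5 = 14 by rewrite eE kE // ABE_low // /=; ring.
have b4 : fcoef (B * E) 4 = 2 by rewrite mulrC fcoefM4 // cE // e0 /=; ring.
have b5 : fcoef (B * E) 5 = 12 by rewrite mulrC fcoefM5 // !cE // e0 e1 /=;
  ring.
have b6 : fcoef (B * E) 6 = 78 by rewrite mulrC fcoefM6 // !cE // e0 e1 e2 /=;
  ring.
have e6 : fcoef E 6 = 88 + 2 * u.
  by rewrite eE fcoefM4 // b4 !kE // /=; ring.
have e7 : fcoef E 7 = 632 + 14 * u.
  by rewrite eE fcoefM5 // b4 b5 !kE // /=; ring.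
have e8 : fcoef E 8 = 5152 + 90 * u.
  (* Literals above 5000 parse as an opaque [Nat.of_num_uint], unknown to [ring]. *)
  have k8 : nth 0%N king_numbers 8 = (4000 + 1242)%N by [].
  by rewrite eE fcoefM6 // b4 b5 b6 !kE // k8 /=; ring.
rewrite -[iota 0 9]/[:: 0; 1; 2; 3; 4; 5; 6; 7; 8]%N /map.
by rewrite e0 e1 e2 e3 e4 e5 e6 e7 e8.
Qed.

Theorem theorem4p4 :
  [/\ (let t : fps int := fpsX in
       let A : fps int := gfA int in
       gfP = (1 + t) ^+ 2 * A / ((1 + t) ^+ 2 + t ^+ 2 * (A - t - 1) * A)),
      (let t : fps {poly int} := fpsX in
       let u : fps {poly int} := fpsC 'X in
       let A : fps {poly int} := gfA {poly int} in
       gfE = (1 + t) ^+ 2 * A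
             / (1 + t * (2 + t * (1 + (1 - u) * (A - t - 1) * A)))) &
      (let u : {poly int} := 'X in
       [seq fcoef gfE n | n <- iota 0 9]
       = [:: 1; 1; 0; 0; 2; 14; 88 + 2 * u; 632 + 14 * u; 5152 + 90 * u])].
Proof.
split; cbv zeta.
- rewrite gfP_occ_gf gfA_king_gf; apply: fps_eq_div; last first.
    rewrite -(occ_gf_eq (0 : int)); congr (_ * (_ + _)).
    have -> : fpsC (0 : int) = 0 by [].
    by rewrite subr0 mul1r.
  (* Written as $1+t(\cdots)$, the denominator visibly has constant term 1. *)
  have -> : (1 + fpsX) ^+ 2 + fpsX ^+ 2 * (king_gf int - fpsX - 1) * king_gf int =
    1 + fpsX * (2 + fpsX * (1 + (king_gf int - fpsX - 1) * king_gf int)) by ring.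
  by rewrite fcoefD fcoefXM fcoef1 addr0.
- rewrite gfE_occ_gf gfA_king_gf; apply: fps_eq_div.
    by rewrite fcoefD fcoefXM fcoef1 addr0.
  rewrite -(occ_gf_eq 'X); congr (_ * _); ring.
- rewrite gfE_occ_gf; exact: occ_gf_upto8.
Qed.
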